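(* Let $p\in(1,\infty)\setminus\{2\}$, let $(X,\Sigma,\lambda)$ be a positive measure space, and let $f,g\in L_p(X)$. Then $f\perp_B g$ if and only if $$\int_X\overline{\operatorname{sgn}(f(x))}\,|f(x)|^{p-1}g(x)\,d\lambda(x)=0.$$
   Context: $\mathbb{K}$ is $\mathbb{R}$ or $\mathbb{C}$; $L_p(X)$ is the usual space of $\mathbb{K}$-valued $p$-integrable functions (modulo a.e. equality) with norm $\|\cdot\|_p$. $\operatorname{sgn}(z)=z/|z|$ for $z\neq0$ and $\operatorname{sgn}(0)=0$. In a normed space over $\mathbb{K}$, $x\perp_B y$ (Birkhoff-James orthogonality) means $\|x+\alpha y\|\ge\|x\|$ for all $\alpha\in\mathbb{K}$. *)

(* Defs.v *)
From HB Require Import structures.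
From mathcomp Require Import all_boot all_order all_algebra.
From mathcomp Require Import all_classical all_reals all_analysis.
From mathcomp Require Import measurable_realfun complex.
Set Implicit Arguments.
Unset Strict Implicit.
Unset Printing Implicit Defensive.
Import Order.TTheory GRing.Theory Num.Theory.
Import numFieldNormedType.Exports.
Local Open Scope classical_set_scope.
Local Open Scope ring_scope.
Local Open Scope quotient_scope.

Variant scalars := RealScalars | ComplexScalars.

Definition scalar_field (R : realType) (k : scalars) : numFieldType :=
  match k with RealScalars => R | ComplexScalars => R[i] end.

Section ScalarOps.
Context {R : realType} {k : scalars}.
Local Notation K := (scalar_field R k).

Definition Kre : K -> R :=
  match k with RealScalars => id | ComplexScalars => @complex.Re R end.

Definition Kim : K -> R :=
  match k with RealScalars => fun=> 0 | ComplexScalars => @complex.Im R end.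

Definition Kreal : R -> K :=
  match k with RealScalars => id | ComplexScalars => fun x => x%:C%C end.

Definition Kconj : K -> K :=
  match k with RealScalars => id | ComplexScalars => @conjc R end.

(* In MathComp the norm of a numFieldType takes values in the field itself;
   this is the same number seen in R. *)
Definition Kabs (z : K) : R := Kre `|z|.

Definition Ksgn (z : K) : K := if z == 0 then 0 else z / `|z|.

Lemma Kreal0 : Kreal 0 = 0.
Proof. by rewrite /Kreal; case: k. Qed.

Lemma KrealD (x y : R) : Kreal (x + y) = Kreal x + Kreal y.
Proof. by rewrite /Kreal; case: k => //; rewrite rmorphD. Qed.

Lemma KrealM (x y : R) : Kreal (x * y) = Kreal x * Kreal y.
Proof. by rewrite /Kreal; case: k => //; rewrite rmorphM. Qed.

Lemma KrealK : cancel Kreal Kre.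
Proof. by rewrite /Kreal /Kre; case: k. Qed.

Lemma ler_Kreal (x y : R) : (Kreal x <= Kreal y) = (x <= y).
Proof. by rewrite /Kreal; case: k => //; rewrite lecR. Qed.

Lemma Kabs_real (z : K) : Kreal (Kabs z) = `|z|.
Proof.
rewrite /Kreal /Kabs /Kre; case: k z => // z; exact/RRe_real/normr_real.
Qed.

Lemma Kabs_ge0 (z : K) : 0 <= Kabs z.
Proof. by rewrite -ler_Kreal Kabs_real Kreal0 normr_ge0. Qed.

Lemma Kabs0 : Kabs 0 = 0.
Proof. by rewrite /Kabs normr0 -Kreal0 KrealK. Qed.

Lemma Kabs_eq0 (z : K) : Kabs z = 0 -> z = 0.
Proof.
by move=> z0; apply/eqP; rewrite -normr_eq0 -Kabs_real z0 Kreal0.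
Qed.

Lemma KabsM (x y : K) : Kabs (x * y) = Kabs x * Kabs y.
Proof.
by rewrite -[RHS]KrealK KrealM !Kabs_real -normrM.
Qed.

Lemma le_KabsD (x y : K) : Kabs (x + y) <= Kabs x + Kabs y.
Proof. by rewrite -ler_Kreal KrealD !Kabs_real ler_normD. Qed.

Lemma KabsE (z : K) : Kabs z = Num.sqrt (Kre z ^+ 2 + Kim z ^+ 2).
Proof.
rewrite /Kabs /Kre /Kim; case: k z => /= z.
  by rewrite expr0n/= addr0 sqrtr_sqr.
exact: (congr1 (@complex.Re R) (normc_def z)).
Qed.

End ScalarOps.

Section ScalarFunctions.
Context {R : realType} {k : scalars} {d} {T : measurableType d}.
Local Notation K := (scalar_field R k).
Implicit Types f g : T -> K^o.

(* The Borel sets of the complex plane are those of the product of two real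
   lines, so Borel measurability means measurability of both parts. *)
Definition Kmeasurable f :=
  measurable_fun [set: T] (fun x => Kre (f x)) /\
  measurable_fun [set: T] (fun x => Kim (f x)).

(* Only meaningful when the real and imaginary parts of h are integrable. *)
Definition Kintegral (mu : {measure set T -> \bar R}) : (T -> K) -> K :=
  match k with
  | RealScalars => fun h => \int[mu]_x h x
  | ComplexScalars => fun h =>
      Complex (\int[mu]_x complex.Re (h x)) (\int[mu]_x complex.Im (h x))
  end.

Lemma Kmeasurable0 : Kmeasurable 0.
Proof.
by rewrite /Kmeasurable /Kre /Kim; case: k => /=; split; exact: measurable_cst.
Qed.

Lemma KmeasurableD f g : Kmeasurable f -> Kmeasurable g -> Kmeasurable (f + g).
Proof.
rewrite /Kmeasurable /Kre /Kim; case: k f g => f g [] f1 f2 [] g1 g2; split => //.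
- exact: measurable_funD.
- rewrite (_ : (fun x => _) = (fun x => complex.Re (f x)) \+
    (fun x => complex.Re (g x))); first exact: measurable_funD.
  apply/funext => x /=; rewrite -[(f + g) x]/(f x + g x).
  by case: (f x) (g x) => ? ? [].
- rewrite (_ : (fun x => _) = (fun x => complex.Im (f x)) \+
    (fun x => complex.Im (g x))); first exact: measurable_funD.
  apply/funext => x /=; rewrite -[(f + g) x]/(f x + g x).
  by case: (f x) (g x) => ? ? [].
Qed.

Lemma KmeasurableZ (a : K) f : Kmeasurable f -> Kmeasurable (a *: f).
Proof.
rewrite /Kmeasurable /Kre /Kim; case: k a f => a f [f1 f2]; split => //.
- exact: measurable_funM.
- rewrite (_ : (fun x => _) = (fun x => complex.Re a * complex.Re (f x)) \-
    (fun x => complex.Im a * complex.Im (f x))).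
    by apply: measurable_funB; exact: measurable_funM.
  apply/funext => x /=; rewrite -[(a *: f) x]/(a * f x).
  by case: a (f x) => ? ? [].
- rewrite (_ : (fun x => _) = (fun x => complex.Re a * complex.Im (f x)) \+
    (fun x => complex.Im a * complex.Re (f x))).
    by apply: measurable_funD; exact: measurable_funM.
  apply/funext => x /=; rewrite -[(a *: f) x]/(a * f x).
  by case: a (f x) => ? ? [].
Qed.

Lemma measurable_Kabs f : Kmeasurable f ->
  measurable_fun [set: T] (fun x => Kabs (f x)).
Proof.
move=> [f1 f2]; under eq_fun do rewrite KabsE.
have msqrt : measurable_fun [set: R] (@Num.sqrt R).
  by apply: continuous_measurable_fun; exact: sqrt_continuous.
apply: (measurableT_comp msqrt).
by apply: measurable_funD; exact: measurable_funX.
Qed.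

End ScalarFunctions.

Section LpFunctions.
Context (R : realType) (k : scalars) d (T : measurableType d).
Context (mu : {measure set T -> \bar R}) (p : R) (p1 : 1 <= p).
Local Notation K := (scalar_field R k).
Implicit Types f g : T -> K^o.

Definition KLnorm f : \bar R := 'N[mu]_p%:E[EFin \o (fun x => Kabs (f x))]%E.

Definition KLfun : {pred T -> K^o} :=
  mem [set f : T -> K^o | Kmeasurable f /\ (KLnorm f < +oo)%E].

Lemma KLfunP f : reflect (Kmeasurable f /\ (KLnorm f < +oo)%E) (f \in KLfun).
Proof. by apply: (iffP idP) => [/set_mem|/mem_set]. Qed.

Let p0 : 0 < p. Proof. exact: lt_le_trans p1. Qed.

Lemma KLnorm_ge0 f : (0 <= KLnorm f)%E.
Proof. exact: Lnorm_ge0. Qed.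

Lemma KLnorm0 : KLnorm 0 = 0%E.
Proof.
rewrite /KLnorm (_ : _ \o _ = cst 0%E); last first.
  by apply/funext => x /=; rewrite Kabs0.
by rewrite Lnorm0// eqe gt_eqF.
Qed.

Lemma le_KLnorm (u v : T -> R) : measurable_fun [set: T] u ->
    measurable_fun [set: T] v -> (forall x, 0 <= u x <= v x) ->
  ('N[mu]_p%:E[EFin \o u] <= 'N[mu]_p%:E[EFin \o v])%E.
Proof.
move=> mu_ mv uv.
have mpow (w : T -> R) : measurable_fun [set: T] w ->
    measurable_fun [set: T] (fun x => `|(EFin \o w) x| `^ p)%E.
  move=> mw; apply: (measurableT_comp (measurable_poweR p)).
  by apply: measurableT_comp => //; exact/measurable_EFinP.
have itvy (x : \bar R) : (0 <= x)%E -> x \in `[0%E, +oo%E].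
  by move=> x0; rewrite in_itv/= x0 leey.
rewrite unlock; apply: gt0_ler_poweR; rewrite ?invr_ge0 ?(ltW p0)//.
- by apply: itvy; apply: integral_ge0 => x _; exact: poweR_ge0.
- by apply: itvy; apply: integral_ge0 => x _; exact: poweR_ge0.
apply: ge0_le_integral => //; do ?[exact: mpow].
  by move=> x _; exact: poweR_ge0.
move=> x _; have /andP[u0 uvx] := uv x.
apply: gt0_ler_poweR; rewrite ?(ltW p0) ?itvy//.
by rewrite lee_fin !ger0_norm// (le_trans u0).
Qed.

Lemma le_KLnormD f g : Kmeasurable f -> Kmeasurable g ->
  (KLnorm (f + g)%R <= KLnorm f + KLnorm g)%E.
Proof.
move=> mf mg; have mfg := measurable_Kabs (KmeasurableD mf mg).
move: mf mg => /measurable_Kabs mf /measurable_Kabs mg.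
have p1e : (1 <= p%:E)%E by rewrite lee_fin.
apply: le_trans (eminkowski mu mf mg p1e).
apply: le_KLnorm => //; first exact: measurable_funD.
by move=> x; rewrite Kabs_ge0 le_KabsD.
Qed.

Lemma KLnormZ (a : K) f : f \in KLfun ->
  KLnorm (a *: f) = ((Kabs a)%:E * KLnorm f)%E.
Proof.
move=> /KLfunP[mf fin].
have p1e : (1 <= p%:E)%E by rewrite lee_fin.
have fL : (fun x => Kabs (f x)) \in Lfun mu p%:E.
  by rewrite inE; apply/andP; split; rewrite inE//=; exact: measurable_Kabs.
have := LnormZ (Lfun_Sub p1e fL) (Kabs a).
rewrite ger0_norm ?Kabs_ge0// => <-.
by apply: eq_Lnorm => x /=; rewrite KabsM.
Qed.

Lemma KLfun_submod_closed : submod_closed KLfun.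
Proof.
split.
  by apply/KLfunP; split; [exact: Kmeasurable0|rewrite KLnorm0].
move=> a f g fL gL.
have /KLfunP[mf nf] := fL; have /KLfunP[mg ng] := gL.
have maf := KmeasurableZ a mf.
apply/KLfunP; split; first exact: KmeasurableD.
apply: le_lt_trans (le_KLnormD maf mg) _.
by rewrite lte_add_pinfty// KLnormZ// lte_mul_pinfty// lee_fin Kabs_ge0.
Qed.

HB.instance Definition _ :=
  GRing.isSubmodClosed.Build _ _ KLfun KLfun_submod_closed.

(* The bound on p only serves to attach the vector space structure. *)
Definition KLfunType of 1 <= p := {f : T -> K^o | f \in KLfun}.
Local Notation ty := (KLfunType p1).
HB.instance Definition _ := SubType.on ty.
HB.instance Definition _ := Choice.on ty.
HB.instance Definition _ := [SubChoice_isSubLmodule of ty by <:].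

Definition KLnull : {pred ty} := mem [set f : ty | val f = 0 %[ae mu]].

Lemma KLnullP (f : ty) : reflect (val f = 0 %[ae mu]) (f \in KLnull).
Proof. by apply: (iffP idP) => [/set_mem|/mem_set]. Qed.

Lemma KLnull_zmod_closed : zmod_closed KLnull.
Proof.
split; first by apply/KLnullP; rewrite raddf0; exact: ae_eq_refl.
move=> f g /KLnullP f0 /KLnullP g0; apply/KLnullP.
rewrite raddfB; apply: filterS2 f0 g0 => x f0 g0 xT.
by rewrite -[LHS]/(val f x - val g x) f0// g0// subrr.
Qed.

HB.instance Definition _ :=
  GRing.isZmodClosed.Build _ KLnull KLnull_zmod_closed.

Definition Lp := Quotient.quot KLnull.
HB.instance Definition _ := EqQuotient.on Lp.
HB.instance Definition _ := Choice.on Lp.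
HB.instance Definition _ := GRing.Zmodule.on Lp.

Lemma Lp_eqP (f g : ty) :
  \pi_Lp f = \pi_Lp g <-> val f = val g %[ae mu].
Proof.
have -> : (\pi_Lp f = \pi_Lp g) = (f - g \in KLnull).
  by rewrite Quotient.idealrBE; apply/propext; exact: rwP eqP.
split => [/KLnullP|fg]; last (apply/KLnullP; move: fg); rewrite raddfB.
  apply: filterS => x + xT => /(_ xT).
  by rewrite -[(_ - _) x]/(val f x - val g x) => /eqP; rewrite subr_eq0 => /eqP.
apply: filterS => x + xT => /(_ xT) fg.
by rewrite -[LHS]/(val f x - val g x) fg subrr.
Qed.

Definition Lp_scale (a : K) (u : Lp) : Lp := \pi_Lp (a *: repr u).

Lemma pi_Lp_scale (a : K) (f : ty) : \pi_Lp (a *: f) = Lp_scale a (\pi_Lp f).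
Proof.
apply/Lp_eqP; rewrite !linearZ.
have : val (repr (\pi_Lp f)) = val f %[ae mu] by apply/Lp_eqP; rewrite reprK.
apply: filterS => x + xT => /(_ xT) fx.
by rewrite -[LHS]/(a * val f x) -[RHS]/(a * val (repr (\pi_Lp f)) x) fx.
Qed.

Lemma Lp_scaleA a b u : Lp_scale a (Lp_scale b u) = Lp_scale (a * b) u.
Proof. by elim/quotW: u => f; rewrite -(pi_Lp_scale b) -!(pi_Lp_scale _ (_ *: _))
  -(pi_Lp_scale (a * b)) scalerA. Qed.

Lemma Lp_scale1 : left_id 1 Lp_scale.
Proof. by elim/quotW => f; rewrite -(pi_Lp_scale 1 f) scale1r. Qed.

Lemma Lp_scaleDr : right_distributive Lp_scale +%R.
Proof.
move=> a; elim/quotW => f; elim/quotW => g.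
by rewrite -raddfD -(pi_Lp_scale a f) -(pi_Lp_scale a g) -(pi_Lp_scale a (f + g))
  scalerDr raddfD.
Qed.

Lemma Lp_scaleDl u : {morph Lp_scale^~ u : a b / a + b}.
Proof.
move=> a b; elim/quotW: u => f.
by rewrite -(pi_Lp_scale a f) -(pi_Lp_scale b f) -(pi_Lp_scale (a + b) f)
  scalerDl raddfD.
Qed.

HB.instance Definition _ := GRing.Zmodule_isLmodule.Build K Lp
  Lp_scaleA Lp_scale1 Lp_scaleDr Lp_scaleDl.

Lemma pi_LpZ (a : K) (f : ty) : \pi_Lp (a *: f) = a *: \pi_Lp f.
Proof. exact: pi_Lp_scale. Qed.

Lemma pi_LpD (f g : ty) : \pi_Lp (f + g) = \pi_Lp f + \pi_Lp g.
Proof. exact: (raddfD \pi_Lp). Qed.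

Definition Lp_norm (u : Lp) : K := Kreal (fine (KLnorm (val (repr u)))).

Lemma KLnorm_ae_eq f g : Kmeasurable f -> Kmeasurable g -> f = g %[ae mu] ->
  KLnorm f = KLnorm g.
Proof.
move=> /measurable_Kabs mf /measurable_Kabs mg fg.
have mpow (w : T -> R) : measurable_fun [set: T] w ->
    measurable_fun [set: T] (fun x => `|(EFin \o w) x| `^ p)%E.
  move=> mw; apply: (measurableT_comp (measurable_poweR p)).
  by apply: measurableT_comp => //; exact/measurable_EFinP.
rewrite /KLnorm unlock; congr (_ `^ _)%E.
apply: ae_eq_integral => //; [exact: mpow|exact: mpow|].
by apply: filterS fg => x /= + xT => /(_ xT) ->.
Qed.

Lemma KLfunType_meas (f : ty) : Kmeasurable (val f).
Proof. by have /KLfunP[] := valP f. Qed.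

Lemma KLnorm_fin (f : ty) : KLnorm (val f) \is a fin_num.
Proof.
by have /KLfunP[_ ?] := valP f; rewrite ge0_fin_numE ?KLnorm_ge0.
Qed.

Lemma Lp_norm_pi (f : ty) : Lp_norm (\pi_Lp f) = Kreal (fine (KLnorm (val f))).
Proof.
congr (Kreal (fine _)).
apply: KLnorm_ae_eq; [exact: KLfunType_meas|exact: KLfunType_meas|].
by apply/Lp_eqP; rewrite reprK.
Qed.

Lemma ler_Lp_normD u v : Lp_norm (u + v) <= Lp_norm u + Lp_norm v.
Proof.
elim/quotW: u => f; elim/quotW: v => g.
rewrite -raddfD !Lp_norm_pi -KrealD ler_Kreal -lee_fin EFinD.
rewrite !fineK ?KLnorm_fin// raddfD.
by apply: le_KLnormD; exact: KLfunType_meas.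
Qed.

Lemma Lp_normZ a u : Lp_norm (a *: u) = `|a| * Lp_norm u.
Proof.
elim/quotW: u => f; rewrite -pi_LpZ !Lp_norm_pi -Kabs_real -KrealM.
congr (Kreal _); apply: EFin_inj; rewrite EFinM !fineK ?KLnorm_fin//.
by rewrite linearZ; apply: KLnormZ; exact: valP.
Qed.

Lemma Lp_norm_eq0 u : Lp_norm u = 0 -> u = 0.
Proof.
elim/quotW: u => f; rewrite Lp_norm_pi => f0.
have /eqP : fine (KLnorm (val f)) = 0
  by rewrite -[LHS](@KrealK R k) f0 -(@Kreal0 R k) KrealK.
rewrite fine_eq0 ?KLnorm_fin// => /eqP /Lnorm_eq0_eq0 => Lf0.
rewrite -(raddf0 \pi_Lp); apply/Lp_eqP; rewrite raddf0.
have /measurable_EFinP mf := measurable_Kabs (KLfunType_meas f).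
have := Lf0 mf; rewrite lte_fin => /(_ p0).
by apply: filterS => x + xT => /(_ xT) [] /Kabs_eq0.
Qed.

HB.instance Definition _ :=
  Lmodule_isNormed.Build K Lp ler_Lp_normD Lp_normZ Lp_norm_eq0.

End LpFunctions.

Arguments Lp {R} k {d T} mu {p} p1.

Section LpElements.
Context {R : realType} {k : scalars} {d} {T : measurableType d}.
Context {mu : {measure set T -> \bar R}} {p : R} {p1 : 1 <= p}.
Local Notation K := (scalar_field R k).
Implicit Types u v : Lp k mu p1.

(* A chosen representative of the class u, determined only up to a.e. equality. *)
Definition Lp_fun u : T -> K := val (repr u).

Lemma Lp_meas u : Kmeasurable (Lp_fun u).
Proof. exact: KLfunType_meas. Qed.

Lemma Lp_fin u : (KLnorm mu p (Lp_fun u) < +oo)%E.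
Proof. by have /KLfunP[] := valP (repr u). Qed.

Lemma Lp_normE u : `|u| = Kreal (fine (KLnorm mu p (Lp_fun u))).
Proof. by []. Qed.

Lemma Lp_funP u v : u = v <-> Lp_fun u = Lp_fun v %[ae mu].
Proof. by rewrite -(Lp_eqP (repr u) (repr v)) !reprK. Qed.

Lemma Lp_funD u v :
  Lp_fun (u + v) = (fun x => Lp_fun u x + Lp_fun v x) %[ae mu].
Proof.
suff : Lp_fun (u + v) = val (repr u + repr v) %[ae mu] by rewrite raddfD.
by apply/Lp_eqP; rewrite pi_LpD !reprK.
Qed.

Lemma Lp_funZ (a : K) u : Lp_fun (a *: u) = (fun x => a * Lp_fun u x) %[ae mu].
Proof.
suff : Lp_fun (a *: u) = val (a *: repr u) %[ae mu] by rewrite linearZ.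
by apply/Lp_eqP; rewrite pi_LpZ !reprK.
Qed.

End LpElements.

Coercion Lp_fun : Lp >-> Funclass.

Definition birkhoff_james (K : numFieldType) (V : normedModType K) (x y : V) :=
  forall a : K, `|x| <= `|x + a *: y|.

(* Main.v *)
Require Import Defs.
From mathcomp Require Import all_boot all_order all_algebra.
From mathcomp Require Import all_classical all_reals all_analysis.
From mathcomp Require Import measurable_realfun ring lra.
Import Order.TTheory GRing.Theory Num.Theory.
Import numFieldNormedType.Exports.
Local Open Scope classical_set_scope.
Local Open Scope ring_scope.

(** Write E(h) for the integral of |h|^p, so that orthogonality of f and g says
    that E(f) <= E(f + a g) for every scalar a, and let
    J(z) = conj(sgn z) |z|^(p-1), so that the integral I in the theorem is that
    of J(f) g.

    Up to the factor p, the real functional w |-> Re (J(z) w) is the derivative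
    at z of the convex function z |-> |z|^p.  Everything follows from the
    corresponding tangent inequality

      |z|^p + p Re (J(z) w) <= |z + w|^p                 (duality_tangent),

    which is Young's inequality p |z|^(p-1) |v| <= (p-1) |z|^p + |v|^p taken at
    v = z + w, because Re (J(z) (z + w)) <= |z|^(p-1) |z + w|.

    If I = 0, integrating the tangent inequality at z = f, w = a g gives
    E(f) + p Re (a I) <= E(f + a g), hence the minimality of E(f).

    Conversely, let f minimize E along the ray f + t h, t > 0.  The tangent
    inequality at the displaced point z = f + t h with w = - t h bounds
    E(f + t h) - E(f) from above by p t times the integral of
    Re (J(f + t h) h), so that this integral is nonnegative.  Since J is
    continuous (cvg_Kre_duality), dominated convergence as t -> 0 yields
    that the integral of Re (J(f) h) is nonnegative
    (energy_min_derivative_ge0).  For h = a g this reads 0 <= Re (a I), and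
    a = - conj I forces I = 0.  Using the tangent inequality at both ends
    avoids differentiating under the integral sign. *)

(** * Real and imaginary parts of scalars *)

Section ScalarFacts.
Context {R : realType} {k : scalars}.
Local Notation K := (scalar_field R k).
Implicit Types z w a : K.

Lemma eqK z w : Kre z = Kre w -> Kim z = Kim w -> z = w.
Proof.
by move: z w; rewrite /Kre /Kim; case: k => //= -[? ?] [? ?] /= -> ->.
Qed.

Lemma KreD z w : Kre (z + w) = Kre z + Kre w.
Proof. by move: z w; rewrite /Kre; case: k => //= -[? ?] [? ?]. Qed.

Lemma KreN z : Kre (- z) = - Kre z.
Proof. by move: z; rewrite /Kre; case: k => //= -[? ?]. Qed.

Lemma KimD z w : Kim (z + w) = Kim z + Kim w.
Proof.
by move: z w; rewrite /Kim; case: k => /= [? ?|[? ?] [? ?]] //; rewrite addr0.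
Qed.

Lemma KreM z w : Kre (z * w) = Kre z * Kre w - Kim z * Kim w.
Proof.
move: z w; rewrite /Kre /Kim; case: k => /= [? ?|[? ?] [? ?]] //.
by rewrite mulr0 subr0.
Qed.

Lemma KimM z w : Kim (z * w) = Kre z * Kim w + Kim z * Kre w.
Proof.
move: z w; rewrite /Kre /Kim; case: k => /= [? ?|[? ?] [? ?]] //.
by rewrite mulr0 mul0r addr0.
Qed.

Lemma Kre_real (r : R) : Kre (Kreal r : K) = r.
Proof. exact: KrealK. Qed.

Lemma Kim_real (r : R) : Kim (Kreal r : K) = 0.
Proof. by rewrite /Kim /Kreal; case: k. Qed.

Lemma Kre0 : Kre (0 : K) = 0.
Proof. by rewrite -Kreal0 Kre_real. Qed.

Lemma Kim0 : Kim (0 : K) = 0.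
Proof. by rewrite -Kreal0 Kim_real. Qed.

Lemma Kre_conj z : Kre (Kconj z) = Kre z.
Proof. by move: z; rewrite /Kre /Kconj; case: k => //= -[]. Qed.

Lemma Kim_conj z : Kim (Kconj z) = - Kim z.
Proof.
by move: z; rewrite /Kim /Kconj; case: k => /= [?|[]] //; rewrite oppr0.
Qed.

Lemma KabsX2 z : Kabs z ^+ 2 = Kre z ^+ 2 + Kim z ^+ 2.
Proof. by rewrite KabsE sqr_sqrtr// addr_ge0// sqr_ge0. Qed.

Lemma Kabs_Kreal (r : R) : 0 <= r -> Kabs (Kreal r : K) = r.
Proof.
move=> r0.
by rewrite KabsE Kre_real Kim_real expr0n/= addr0 sqrtr_sqr ger0_norm.
Qed.

Lemma le_norm_Kre z : `|Kre z| <= Kabs z.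
Proof. by rewrite KabsE -sqrtr_sqr ler_wsqrtr// lerDl sqr_ge0. Qed.

Lemma le_norm_Kim z : `|Kim z| <= Kabs z.
Proof. by rewrite KabsE -sqrtr_sqr ler_wsqrtr// lerDr sqr_ge0. Qed.

End ScalarFacts.

(** * The derivative of the p-th power of the modulus *)

Section Duality.
Context {R : realType} {k : scalars} (p : R) (p_gt1 : 1 < p).
Local Notation K := (scalar_field R k).
Implicit Types z w a : K.

(** The conjugate of the gradient of |z|^p / p: up to a factor, the functional
    that norms f in L_p integrates duality f against its argument. *)
Definition duality z : K := Kconj (Ksgn z) * Kreal (Kabs z `^ (p - 1)).

Let p_gt0 : 0 < p. Proof. exact: lt_trans p_gt1. Qed.
Let p1_neq0 : p - 1 != 0. Proof. by rewrite subr_eq0 gt_eqF. Qed.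

Lemma powR_sub2 (r : R) : 0 <= r -> r `^ (p - 2) * r = r `^ (p - 1).
Proof.
move=> r0; have [->|rn0] := eqVneq r 0; first by rewrite mulr0 powR0.
rewrite (_ : p - 1 = (p - 2) + 1); last by ring.
by rewrite [RHS]powRD ?rn0 ?implybT// powRr1.
Qed.

(** Unlike the definition, this form makes the real and imaginary parts
    polynomial in those of z apart from one power of the modulus; at z = 0
    the factor Kconj z gives the value 0, whatever 0 `^ (p - 2) is. *)
Lemma dualityE z : duality z = Kreal (Kabs z `^ (p - 2)) * Kconj z.
Proof.
rewrite /duality /Ksgn; have [->|z0] := eqVneq z 0.
  rewrite Kabs0 powR0//; apply: eqK;
    rewrite ?KreM ?KimM ?Kre_conj ?Kim_conj ?Kre_real ?Kim_real;
    by rewrite Kre0 Kim0; ring.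
have a0 : Kabs z != 0 by apply: contra_neq z0 => /Kabs_eq0.
rewrite -(powR_sub2 _ (Kabs_ge0 z)).
have -> : z / `|z| = Kreal (Kabs z)^-1 * z.
  rewrite mulrC -Kabs_real; congr (_ * _); apply: (mulIf (x := Kreal (Kabs z))).
    by rewrite -Kreal0 (can_eq KrealK).
  rewrite -KrealM !mulVf// ?(can_eq KrealK)//; last first.
    by rewrite -Kreal0 (can_eq KrealK).
  by apply: eqK; rewrite ?Kre_real ?Kim_real /Kre /Kim; case: k.
apply: eqK; rewrite !(KreM, KimM, Kre_conj, Kim_conj, Kre_real, Kim_real);
  by field.
Qed.

Lemma Kre_duality z w :
  Kre (duality z * w) = Kabs z `^ (p - 2) * (Kre z * Kre w + Kim z * Kim w).
Proof.
rewrite dualityE !(KreM, KimM, Kre_conj, Kim_conj, Kre_real, Kim_real); ring.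
Qed.

Lemma Kim_duality z w :
  Kim (duality z * w) = Kabs z `^ (p - 2) * (Kre z * Kim w - Kim z * Kre w).
Proof.
rewrite dualityE !(KreM, KimM, Kre_conj, Kim_conj, Kre_real, Kim_real); ring.
Qed.

Lemma Kabs_duality z : Kabs (duality z) = Kabs z `^ (p - 1).
Proof.
rewrite dualityE KabsM Kabs_Kreal ?powR_ge0//.
rewrite -(powR_sub2 _ (Kabs_ge0 z)); congr (_ * _).
by rewrite !KabsE Kre_conj Kim_conj sqrrN.
Qed.

Lemma Kre_duality_self z : Kre (duality z * z) = Kabs z `^ p.
Proof.
rewrite Kre_duality -!expr2 -KabsX2 expr2 mulrA powR_sub2 ?Kabs_ge0//.
by rewrite mulrC mulr_powRB1 ?Kabs_ge0.
Qed.

(** Young's inequality for the conjugate exponents p and p / (p - 1), with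
    a `^ (p - 1) as one of the factors. *)
Lemma young_powR (a b : R) : 0 <= a -> 0 <= b ->
  p * (a `^ (p - 1) * b) <= (p - 1) * a `^ p + b `^ p.
Proof.
move=> a0 b0; have q0 : 0 < p / (p - 1) by rewrite divr_gt0// subr_gt0.
have := @conjugate_powR R b (a `^ (p - 1)) p (p / (p - 1))
  b0 (powR_ge0 _ _) p_gt0 q0.
rewrite -powRrM mulrCA divff// mulr1 => /(_ _)/wrap[].
  by field; rewrite p1_neq0 gt_eqF.
rewrite -(ler_pM2l p_gt0) (mulrC (a `^ (p - 1))) => /le_trans; apply.
rewrite le_eqVlt; apply/orP; left; apply/eqP.
by field; rewrite p1_neq0 gt_eqF.
Qed.

(** Convexity of the p-th power of the modulus, with an explicit subgradient.
    Only Re v <= |v| and Young's inequality enter. *)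
Lemma duality_tangent z w :
  Kabs z `^ p + p * Kre (duality z * w) <= Kabs (z + w) `^ p.
Proof.
have := young_powR _ _ (Kabs_ge0 z) (Kabs_ge0 (z + w)).
have := le_trans (ler_norm _) (le_norm_Kre (duality z * (z + w))).
rewrite KabsM Kabs_duality -(ler_pM2l p_gt0) mulrDr KreD Kre_duality_self.
by lra.
Qed.

Lemma norm_Kre_duality_le z w :
  `|Kre (duality z * w)| <= Kabs z `^ (p - 1) * Kabs w.
Proof. by rewrite -Kabs_duality -KabsM le_norm_Kre. Qed.

Lemma norm_Kim_duality_le z w :
  `|Kim (duality z * w)| <= Kabs z `^ (p - 1) * Kabs w.
Proof. by rewrite -Kabs_duality -KabsM le_norm_Kim. Qed.

(** Makes the products duality f * h integrable without a detour through the
    dual exponent. *)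
Lemma powR_mul_le (a b : R) : 0 <= a -> 0 <= b ->
  a `^ (p - 1) * b <= a `^ p + b `^ p.
Proof.
move=> a0 b0; have := young_powR _ _ a0 b0.
have := powR_ge0 a p; have := powR_ge0 b p; have := p_gt1.
move: (a `^ p) (b `^ p) (_ * b) => A B C; nra.
Qed.

(** A crude form of convexity, enough to dominate the translates f + t h. *)
Lemma powR_addr_le (a b : R) : 0 <= a -> 0 <= b ->
  (a + b) `^ p <= 2 `^ p * (a `^ p + b `^ p).
Proof.
wlog ab : a b / a <= b => [H a0 b0|a0 b0].
  case: (leP a b) => [|/ltW] ab; first exact: H.
  by rewrite addrC [X in _ * X]addrC; exact: H.
apply: (@le_trans _ _ ((2 * b) `^ p)).
  by apply: ge0_ler_powR; rewrite ?nnegrE ?(ltW p_gt0)//; lra.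
by rewrite powRM// ler_wpM2l ?powR_ge0// lerDr powR_ge0.
Qed.

(** Continuity of the derivative along a ray.  The origin needs its own
    argument, since for p < 2 the factor |z|^(p-2) is unbounded there; it is
    the hypothesis p > 1 that brings the values to 0. *)
Lemma cvg_Kre_duality z w :
  Kre (duality (z + Kreal t * w) * w) @[t --> 0^'+] --> Kre (duality z * w).
Proof.
have [->|z0] := eqVneq z 0.
  have -> : Kre (duality 0 * w) = 0.
    by rewrite Kre_duality Kre0 Kim0 !mul0r addr0 mulr0.
  have : t `^ (p - 1) * Kabs w `^ p @[t --> 0^'+] --> 0.
    rewrite -[X in _ --> X](mul0r (Kabs w `^ p)).
    by apply: cvgM; [apply: powR_cvg0; rewrite subr_gt0|exact: cvg_cst].
  apply: cvg_trans; apply: near_eq_cvg.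
  near=> t; have t0 : 0 <= t by near: t; exact: nbhs_right_ge.
  rewrite Kre_duality add0r KabsM Kabs_Kreal// powRM ?Kabs_ge0//.
  rewrite KreM KimM Kre_real Kim_real !mul0r subr0 addr0 -!mulrA -mulrDr.
  rewrite -!expr2 -KabsX2 -(powR_sub2 t)// -(mulr_powRB1 _ p_gt0) ?Kabs_ge0//.
  by rewrite -(powR_sub2 _ (Kabs_ge0 w)); ring.
have a0 : 0 < Kabs z.
  by rewrite lt_def Kabs_ge0 andbT; apply: contra_neq z0 => /Kabs_eq0.
have reE t : Kre (z + Kreal t * w) = Kre z + t * Kre w.
  by rewrite KreD KreM Kre_real Kim_real mul0r subr0.
have imE t : Kim (z + Kreal t * w) = Kim z + t * Kim w.
  by rewrite KimD KimM Kre_real Kim_real mul0r addr0.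
have cvg_affine (a b : R) : a + t * b @[t --> 0] --> a.
  rewrite -[X in _ --> X]addr0 -[X in _ --> _ + X](mul0r b).
  by apply: cvgD; [exact: cvg_cst|apply: cvgM; [exact: cvg_id|exact: cvg_cst]].
have cvg_re : Kre (z + Kreal t * w) @[t --> 0] --> Kre z.
  by under eq_fun do rewrite reE; exact: cvg_affine.
have cvg_im : Kim (z + Kreal t * w) @[t --> 0] --> Kim z.
  by under eq_fun do rewrite imE; exact: cvg_affine.
apply: cvg_at_right_filter; under eq_fun do rewrite Kre_duality.
rewrite Kre_duality; apply: cvgM; last first.
  by apply: cvgD; apply: cvgM => //; exact: cvg_cst.
have cvg_abs : Kabs (z + Kreal t * w) @[t --> 0] --> Kabs z.
  under eq_fun do rewrite KabsE; rewrite KabsE.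
  apply: continuous_cvg; first exact: sqrt_continuous.
  by apply: cvgD; rewrite !expr2; apply: cvgM.
apply: (@continuous_cvg _ R R _ _ _ (fun r => r `^ (p - 2)) _ _ cvg_abs).
apply: differentiable_continuous; apply/derivable1_diffP.
by apply: derivable_powR; rewrite in_itv/= a0.
Unshelve. all: by end_near. Qed.

End Duality.

(** * Integration of the tangent inequality *)

Section Integration.
Context {R : realType} {k : scalars} {d} {T : measurableType d}.
Context (mu : {measure set T -> \bar R}) (p : R) (p_gt1 : 1 < p).
Local Notation K := (scalar_field R k).
Implicit Types f g h : T -> K^o.
Local Notation p_integrable f := (f \in KLfun mu p).
Local Notation energy f := (\int[mu]_x (Kabs (f x) `^ p)).

Let p_gt0 : 0 < p. Proof. exact: lt_trans p_gt1. Qed.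

Lemma Kre_Kintegral (u : T -> K) : Kre (Kintegral mu u) = \int[mu]_x Kre (u x).
Proof. by move: u; rewrite /Kre /Kintegral; case: k. Qed.

Lemma Kim_Kintegral (u : T -> K) : Kim (Kintegral mu u) = \int[mu]_x Kim (u x).
Proof.
move: u; rewrite /Kim /Kintegral; case: k => //= _.
by rewrite /Rintegral integral0.
Qed.

Lemma measurable_energy f : Kmeasurable f ->
  measurable_fun [set: T] (fun x => Kabs (f x) `^ p).
Proof.
move=> mf; apply: (measurableT_comp (measurable_powR _)).
exact: measurable_Kabs.
Qed.

Lemma poweR_KLnorm f :
  (KLnorm mu p f `^ p = \int[mu]_x (Kabs (f x) `^ p)%:E)%E.
Proof.
have pn0 : p != 0 by rewrite gt_eqF.
rewrite /KLnorm (poweR_Lnorm _ _ pn0); apply: eq_integral => x _ /=.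
by rewrite ger0_norm ?Kabs_ge0.
Qed.

Lemma integrable_energy f : p_integrable f ->
  mu.-integrable [set: T] (EFin \o (fun x => Kabs (f x) `^ p)).
Proof.
move=> /KLfunP[mf fin]; apply/integrableP; split.
  by apply/measurable_EFinP; exact: measurable_energy.
under eq_integral => x _ do rewrite /= ger0_norm ?powR_ge0//.
by rewrite -poweR_KLnorm; exact: poweR_lty.
Qed.

Lemma powR_fine_KLnorm f : p_integrable f ->
  fine (KLnorm mu p f) `^ p = energy f.
Proof.
move=> /KLfunP[mf fin]; rewrite /Rintegral -poweR_KLnorm.
have : KLnorm mu p f \is a fin_num by rewrite ge0_fin_numE ?KLnorm_ge0.
by case: (KLnorm mu p f).
Qed.

Lemma le_fine_KLnorm f g : p_integrable f -> p_integrable g ->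
  (fine (KLnorm mu p f) <= fine (KLnorm mu p g)) = (energy f <= energy g).
Proof.
move=> Lf Lg; rewrite -!powR_fine_KLnorm//.
set a := fine _; set b := fine _.
have [a0 b0] : 0 <= a /\ 0 <= b by split; apply: fine_ge0; exact: KLnorm_ge0.
case: (leP a b) => ab; apply/esym.
  by apply: ge0_ler_powR; rewrite ?nnegrE// ltW.
by apply/negbTE; rewrite -ltNge; apply: gt0_ltr_powR.
Qed.

Lemma integrable_Kre_duality f h : p_integrable f -> p_integrable h ->
  mu.-integrable [set: T] (EFin \o (fun x => Kre (duality p (f x) * h x))).
Proof.
move=> Lf Lh; have /KLfunP[mf _] := Lf; have /KLfunP[mh _] := Lh.
have [mf1 mf2] := mf; have [mh1 mh2] := mh.
apply: le_integrable
  (integrableD _ (integrable_energy _ Lf) (integrable_energy _ Lh)) => //.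
  apply/measurable_EFinP; under eq_fun do rewrite Kre_duality//.
  apply: measurable_funM.
    by apply: (measurableT_comp (measurable_powR _)); exact: measurable_Kabs.
  by apply: measurable_funD; exact: measurable_funM.
move=> x _ /=; rewrite lee_fin [X in _ <= X]ger0_norm ?addr_ge0 ?powR_ge0//.
apply: le_trans (norm_Kre_duality_le _ _ _ _) (powR_mul_le _ _ _ _ _ _) => //.
  exact: Kabs_ge0.
exact: Kabs_ge0.
Qed.

Lemma integrable_Kim_duality f h : p_integrable f -> p_integrable h ->
  mu.-integrable [set: T] (EFin \o (fun x => Kim (duality p (f x) * h x))).
Proof.
move=> Lf Lh; have /KLfunP[mf _] := Lf; have /KLfunP[mh _] := Lh.
have [mf1 mf2] := mf; have [mh1 mh2] := mh.
apply: le_integrable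
  (integrableD _ (integrable_energy _ Lf) (integrable_energy _ Lh)) => //.
  apply/measurable_EFinP; under eq_fun do rewrite Kim_duality//.
  apply: measurable_funM.
    by apply: (measurableT_comp (measurable_powR _)); exact: measurable_Kabs.
  by apply: measurable_funB; exact: measurable_funM.
move=> x _ /=; rewrite lee_fin [X in _ <= X]ger0_norm ?addr_ge0 ?powR_ge0//.
apply: le_trans (norm_Kim_duality_le _ _ _ _) (powR_mul_le _ _ _ _ _ _) => //.
  exact: Kabs_ge0.
exact: Kabs_ge0.
Qed.

Lemma p_integrable_addZ (a : K) f g : p_integrable f -> p_integrable g ->
  p_integrable ((fun x => f x + a * g x) : T -> K^o).
Proof.
move=> Lf Lg; have [_ /(_ a g f Lg Lf)] := KLfun_submod_closed k mu (ltW p_gt1).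
by rewrite addrC.
Qed.

Lemma p_integrable_Z (a : K) g : p_integrable g ->
  p_integrable ((fun x => a * g x) : T -> K^o).
Proof.
move=> Lg; have [L0 /(_ a g 0 Lg L0)] := KLfun_submod_closed k mu (ltW p_gt1).
by rewrite addr0.
Qed.

(** The convexity of the energy, inherited from that of the p-th power of the
    modulus at each point. *)
Lemma energy_tangent f h : p_integrable f -> p_integrable h ->
    p_integrable ((fun x => f x + h x) : T -> K^o) ->
  energy f + p * \int[mu]_x Kre (duality p (f x) * h x)
    <= \int[mu]_x (Kabs (f x + h x) `^ p).
Proof.
move=> Lf Lh Lfh; have If := integrable_energy _ Lf.
have IJ := integrable_Kre_duality _ _ Lf Lh.
have IpJ : mu.-integrable [set: T]
    (EFin \o (fun x => p * Kre (duality p (f x) * h x))).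
  by under [EFin \o _]eq_fun do rewrite /= EFinM; exact: integrableZl.
rewrite -RintegralZl// -RintegralD//; apply: le_Rintegral => //.
- by under [EFin \o _]eq_fun do rewrite /= EFinD; exact: integrableD.
- exact: integrable_energy.
- by move=> x _; exact: duality_tangent.
Qed.

(** The scalar a lets the real functionals Re (a I) recover the whole scalar
    integral I. *)
Lemma Rintegral_Kre_dualityZ (a : K) f g : p_integrable f -> p_integrable g ->
  \int[mu]_x Kre (duality p (f x) * (a * g x)) =
  Kre (a * Kintegral mu (fun x => duality p (f x) * g x)).
Proof.
move=> Lf Lg; rewrite KreM Kre_Kintegral Kim_Kintegral.
have Ir := integrable_Kre_duality _ _ Lf Lg.
have Ii := integrable_Kim_duality _ _ Lf Lg.
rewrite -!RintegralZl// -RintegralB//.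
- by apply: eq_Rintegral => x _; rewrite mulrCA [LHS]KreM.
- by under [EFin \o _]eq_fun do rewrite /= EFinM; exact: integrableZl.
- by under [EFin \o _]eq_fun do rewrite /= EFinM; exact: integrableZl.
Qed.

(** The one-sided derivative of the energy at a minimum is nonnegative.  It is
    reached as a limit of the tangent slopes at f + t h, each of which is
    nonnegative because the tangent there lies below the energy of f. *)
Lemma energy_min_derivative_ge0 f h : p_integrable f -> p_integrable h ->
  (forall t : R, 0 < t ->
     energy f <= \int[mu]_x (Kabs (f x + Kreal t * h x) `^ p)) ->
  0 <= \int[mu]_x Kre (duality p (f x) * h x).
Proof.
move=> Lf Lh fmin.
pose t n : R := n.+1%:R^-1.
have t0 n : 0 < t n by rewrite invr_gt0.
have t1 n : t n <= 1 by rewrite invf_le1// ler1n.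
have cvg_t : t @ \oo --> 0^'+.
  move=> A [e /= e0 eA]; have := near_infty_natSinv_lt (PosNum e0).
  apply: filterS => n /= te; apply: eA => //=.
  by rewrite sub0r normrN gtr0_norm.
pose ft n : T -> K^o := fun x => f x + Kreal (t n) * h x.
have Lft n : p_integrable (ft n) by exact: p_integrable_addZ.
have Jt_ge0 n : 0 <= \int[mu]_x Kre (duality p (ft n x) * h x).
  (* Going back from the displaced point, by - t h, returns to f. *)
  have ftK x : ft n x + Kreal (- t n) * h x = f x.
    by rewrite /ft -addrA -mulrDl -KrealD subrr Kreal0 mul0r addr0.
  have -> : \int[mu]_x Kre (duality p (ft n x) * h x) =
      - (t n)^-1 * \int[mu]_x Kre (duality p (ft n x) * (Kreal (- t n) * h x)).
    rewrite -RintegralZl//; last first.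
      by apply: integrable_Kre_duality => //; exact: p_integrable_Z.
    apply: eq_Rintegral => x _.
    rewrite mulrCA [in RHS]KreM Kre_real Kim_real mul0r subr0 mulrA mulrNN.
    by rewrite mulVf ?mul1r// gt_eqF.
  have := energy_tangent _ _ (Lft n) (p_integrable_Z (Kreal (- t n)) _ Lh)
    (p_integrable_addZ _ _ _ (Lft n) Lh).
  under [X in _ <= X -> _]eq_Rintegral do rewrite ftK.
  move=> /le_trans/(_ (fmin _ (t0 n))); rewrite gerDl pmulr_rle0// => J0.
  by rewrite mulNr oppr_ge0 pmulr_rle0// invr_gt0.
(* Dominates |f + t h|^p + |h|^p uniformly in 0 < t <= 1. *)
pose G x := 2 `^ p * (Kabs (f x) `^ p + Kabs (h x) `^ p) + Kabs (h x) `^ p.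
have := @dominated_convergence _ _ _ mu setT measurableT
  (fun n x => (Kre (duality p (ft n x) * h x))%:E)
  (fun x => (Kre (duality p (f x) * h x))%:E) (EFin \o G).
case.
- by move=> n; have /integrableP[] := integrable_Kre_duality _ _ (Lft n) Lh.
- by have /integrableP[] := integrable_Kre_duality _ _ Lf Lh.
- apply/nearW => x _; apply: cvg_EFin; first exact: nearW.
  exact: (cvg_comp _ _ cvg_t (cvg_Kre_duality _ p_gt1 (f x) (h x))).
- have Ih := integrable_energy _ Lh; have If := integrable_energy _ Lf.
  set F := EFin \o _ in If; set H := EFin \o _ in Ih.
  rewrite (_ : EFin \o G = ((fun x => (2 `^ p)%:E * (F \+ H) x) \+ H)%E)//.
  by apply: integrableD => //; apply: integrableZl => //; exact: integrableD.
- apply/nearW => x n _; rewrite /= lee_fin.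
  apply: le_trans (norm_Kre_duality_le _ p_gt1 _ _) _.
  apply: le_trans (powR_mul_le _ p_gt1 _ _ (Kabs_ge0 _) (Kabs_ge0 _)) _.
  rewrite lerD2r.
  apply: le_trans (powR_addr_le _ p_gt1 _ _ (Kabs_ge0 _) (Kabs_ge0 _)).
  apply: ge0_ler_powR; rewrite ?nnegrE ?addr_ge0 ?Kabs_ge0 ?(ltW p_gt0)//.
  apply: le_trans (le_KabsD _ _) _; rewrite lerD2l KabsM.
  by rewrite Kabs_Kreal ?(ltW (t0 n))// ler_piMl ?Kabs_ge0.
move=> _ _ cvgJ; apply: fine_ge0.
rewrite -(cvg_lim _ cvgJ)//; apply: lime_ge.
  by apply/cvg_ex; eexists; exact: cvgJ.
apply: nearW => n /=.
rewrite -[leRHS]fineK; first by rewrite lee_fin; exact: Jt_ge0.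
by apply: integrable_fin_num => //; exact: integrable_Kre_duality.
Qed.

Lemma energy_min_iff f g : p_integrable f -> p_integrable g ->
  (forall a : K, energy f <= \int[mu]_x (Kabs (f x + a * g x) `^ p)) <->
  Kintegral mu (fun x => duality p (f x) * g x) = 0.
Proof.
move=> Lf Lg; split=> [fmin|I0 a]; last first.
  have := energy_tangent _ _ Lf (p_integrable_Z a _ Lg)
    (p_integrable_addZ _ _ _ Lf Lg).
  by rewrite Rintegral_Kre_dualityZ// I0 mulr0 Kre0 mulr0 addr0.
set I := Kintegral _ _.
(* The direction of steepest descent: here the derivative is - |I|^2. *)
have : 0 <= Kre (- Kconj I * I).
  rewrite -Rintegral_Kre_dualityZ//; apply: energy_min_derivative_ge0 => //.
    exact: p_integrable_Z.
  by move=> t t0; under [leRHS]eq_Rintegral do rewrite mulrA; exact: fmin.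
rewrite mulNr KreN KreM Kre_conj Kim_conj mulNr opprK -!expr2 -KabsX2 oppr_ge0.
by move=> I0; apply: Kabs_eq0; apply/eqP; rewrite -sqrf_eq0 eq_le I0 sqr_ge0.
Qed.

(** Passing from classes to representatives, and from norms to their p-th
    powers, which the strict monotonicity of powers permits. *)
Lemma birkhoff_james_energy (p_ge1 : 1 <= p) (f g : Lp k mu p_ge1) :
  birkhoff_james f g <->
  forall a : K, energy f <= \int[mu]_x (Kabs (f x + a * g x) `^ p).
Proof.
have Lf : p_integrable (Lp_fun f) by exact: valP.
have Lg : p_integrable (Lp_fun g) by exact: valP.
suff E (a : K) : (`|f| <= `|f + a *: g|) =
    (energy f <= \int[mu]_x (Kabs (f x + a * g x) `^ p)).
  by split=> H a; [rewrite -E|rewrite E]; exact: H.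
have Lfg := p_integrable_addZ a _ _ Lf Lg.
rewrite !Lp_normE ler_Kreal -le_fine_KLnorm//.
rewrite (_ : KLnorm mu p (Lp_fun (f + a *: g)) =
  KLnorm mu p ((fun x => f x + a * g x) : T -> K^o))//.
apply: KLnorm_ae_eq; first exact: Lp_meas.
  by have /KLfunP[] := Lfg.
apply: filterS2 (Lp_funD f (a *: g)) (Lp_funZ a g) => x + + xT.
by move=> /(_ xT) -> /(_ xT) ->.
Qed.

End Integration.

(** * The orthogonality criterion *)

Theorem theorem4p0p2 (R : realType) (k : scalars) (d : measure_display)
    (X : measurableType d) (lambda : {measure set X -> \bar R})
    (p : R) (p_gt1 : 1 < p) (p_neq2 : p != 2) (f g : Lp k lambda (ltW p_gt1)) :
  birkhoff_james f g <->
  Kintegral lambda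
    (fun x => Kconj (Ksgn (f x)) * Kreal (Kabs (f x) `^ (p - 1)) * g x) = 0.
Proof.
rewrite birkhoff_james_energy//; apply: energy_min_iff => //; exact: valP.
Qed.
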